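(* Given a pair of positive integers $(d,r)$ such that $d\ge 4$, $k=d-r$ is odd and $$\frac d2\le r\le\frac34(d-1),$$ there is a real line arrangement $\mathcal A$ in $\mathbb P^2$ which is Tjurina maximal of type $(d,r)$.
   Context: A line arrangement $\mathcal A$ in $\mathbb P^2$ (over a field of characteristic zero, e.g. $\mathbb C$) is a finite set of distinct lines, given by $f=0$ with $f\in S=\mathbb K[x,y,z]$ a product of $d$ pairwise non-proportional linear forms; it is real if these linear forms can be chosen with real coefficients. $r(\mathcal A)$ is the minimal degree $r$ for which there is a nonzero triple $(a,b,c)\in S_r^3$ with $af_x+bf_y+cf_z=0$. The global Tjurina number is $\tau(\mathcal A)=\sum_{j\ge 2}n_j(j-1)^2$, where $n_j$ is the number of points lying on exactly $j$ lines of $\mathcal A$. Set $\tau(d,r)_{max}=(d-1)(d-r-1)+r^2$ if $r<d/2$, and $\tau(d,r)_{max}=(d-1)(d-r-1)+r^2-\binom{2r-d+2}{2}$ if $d/2\le r\le d-1$. $\mathcal A$ is called Tjurina maximal (maximal Tjurina) of type $(d,r)$ if it has $d$ lines, $r(\mathcal A)=r$ and $\tau(\mathcal A)=\tau(d,r)_{max}$. *)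

(* Defs.v *)
From mathcomp Require Import all_boot all_order all_algebra.
From mathcomp Require Import finmap mpoly complex.
From mathcomp Require Import boolp classical_sets functions cardinality.
From mathcomp Require Import reals.

Set Implicit Arguments.
Unset Strict Implicit.
Unset Printing Implicit Defensive.

Import Order.TTheory GRing.Theory Num.Theory.

Local Open Scope ring_scope.

Section Arrangement.
Variables (K : fieldType) (d : nat).

(* A family of [d] linear forms in x, y, z; the i-th line is [A i = 0].  The
   conditions below say that these are [d] distinct lines of the plane. *)
Implicit Type A : 'I_d -> {mpoly K[3]}.

Definition line_arrangement A : Prop :=
  [/\ forall i, A i \is 1.-homog,
      forall i, A i != 0
    & forall i j, i != j -> forall c : K, A i != c *: A j].

Definition defining_poly A : {mpoly K[3]} := \prod_(i < d) A i.

(* A nonzero triple of forms of degree [r]; note that 0 is [r.-homog]. *)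
Definition has_jacobian_syzygy (f : {mpoly K[3]}) (r : nat) : Prop :=
  exists a : 'I_3 -> {mpoly K[3]},
    [/\ forall i, a i \is r.-homog,
        exists i, a i != 0
      & \sum_(i < 3) a i * f^`M(i) = 0].

Definition min_syzygy_degree A (r : nat) : Prop :=
  has_jacobian_syzygy (defining_poly A) r /\
  (forall s, has_jacobian_syzygy (defining_poly A) s -> (r <= s)%N).

(* Points of the projective plane are the 1-dimensional subspaces of K^3. *)
Definition on_line (p : {vspace 'rV[K]_3}) (l : {mpoly K[3]}) : Prop :=
  forall v : 'rV[K]_3, v \in p -> l.@[v 0] = 0.

Definition multiple_points A (j : nat) : set {vspace 'rV[K]_3} :=
  [set p | \dim p = 1%N /\ #|[pred i : 'I_d | `[< on_line p (A i) >]]| = j]%classic.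

(* [fset_set] is the expected finite set only on finite sets, which
   [multiple_points A j] is for an arrangement [A] and j >= 2. *)
Definition nb_multiple_points A (j : nat) : nat :=
  #|` fset_set (multiple_points A j)|.

(* At most [d] lines pass through a point, so the sum may stop at j = d. *)
Definition global_tjurina A : nat :=
  (\sum_(2 <= j < d.+1) nb_multiple_points A j * (j - 1) ^ 2)%N.

End Arrangement.

(* Only meaningful for r <= d - 1. *)
Definition tjurina_max (d r : nat) : int :=
  let t := (d%:Z - 1) * (d%:Z - r%:Z - 1) + r%:Z ^+ 2 in
  if (2 * r < d)%N then t else t - 'C(2 * r + 2 - d, 2)%:Z.

Definition tjurina_maximal (K : fieldType) (d r : nat)
    (A : 'I_d -> {mpoly K[3]}) : Prop :=
  [/\ line_arrangement A,
      min_syzygy_degree A r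
    & (global_tjurina A)%:Z = tjurina_max d r].

(* In the partial order of R[i], [Num.real] is exactly the subfield R. *)
Definition real_arrangement (R : realType) (d : nat)
    (A : 'I_d -> {mpoly R[i][3]}) : Prop :=
  forall i, exists2 c : R[i], c != 0 & c *: A i \is a mpolyOver 3 Num.real.

(* Main.v *)
Require Import Defs.
From mathcomp Require Import all_boot all_order all_algebra.
From mathcomp Require Import finmap mpoly complex.
From mathcomp Require Import boolp classical_sets functions cardinality.
From mathcomp Require Import reals.
From mathcomp Require Import zify ring lra.

(** Put [n = d - r - 1], an even number, and work in the affine chart [z = 1].
The arrangement consists of the first [d] lines of the following list: the
line at infinity; the [n] lines [x = a]; the [n] lines [y = b]; the [n] lines
[x - y = c], where [a], [b], [c] run over [1, ..., n]; and [n] lines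
[x + y = m] for well chosen integers [m].  It is built one line at a time, and
both invariants are controlled by the number [s] of distinct points in which
the new line meets the lines already present.

Tjurina number: a point of multiplicity [q] contributes [(q - 1)^2] before and
[q^2] after a new line goes through it.  Each of the [D] earlier lines meets
the new one exactly once, so the increase is the sum of [2 q - 1] over the [s]
points, that is [2 D - s] ([tjurina_addition]).

Lower bound for the syzygy degree: a syzygy is a polynomial vector field
[theta] that kills [f]; it is tangent to every line.  Modulo the Euler field it
is recorded by the cross product [W] of [theta] with [(x, y, z)], which is
proportional to the coefficients of a line of the arrangement at all points of
that line.  Suppose that for the first [D] lines this property forces [W = 0]
in degree at most [N], and that the next line meets them in at least [N + 2]
points.  Then the property for [D + 1] lines forces [W = 0] in degree at most
[N + 1]: at the intersection points [W] is proportional to two independent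
vectors, hence zero; by degree it vanishes along the new line; and the quotient
by the equation of that line is covered by the assumption ([rigid_step]).
Starting from the pencil of the [n + 1] lines through [(0 : 1 : 0)], with
[N = 0], each further line raises [N] by one, and [N] ends at
[d - (n + 1) = r].

Upper bound: a point of multiplicity [k] always produces a syzygy of degree
[d - k] ([pencil_syzygy]); the pencil above has [k = n + 1].

It remains to make [s] right.  After the [2 n + 1] lines of the grid, a new
line that meets the [D] earlier ones in exactly [D - n + 1] points is allowed by
the lower bound and gives precisely the increase of the maximal Tjurina number.
The line [x - y = c] does this because it contains [n - c] of the grid points.
The lines [x + y = m] do it when the [j]-th of them has [n - j] coincidences
among its affine intersection points; half of the lines [x - y = c] meet it in
integral points, the coincidences are counted there and on the grid, and this is
where [n] has to be even ([size_labels_antidiagonal]). *)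

Set Implicit Arguments.
Unset Strict Implicit.
Unset Printing Implicit Defensive.

Import Order.TTheory GRing.Theory Num.Theory.

Local Open Scope ring_scope.

(** * Polynomials as functions *)

Section PolynomialEvaluation.
Variables (K : numFieldType) (n : nat).
Implicit Types (F G : {mpoly K[n]}) (u v w : 'I_n -> K).

Lemma mpoly_ring_ind (P : {mpoly K[n]} -> Prop) :
  (forall c, P c%:MP) -> (forall i, P 'X_i) ->
  (forall F G, P F -> P G -> P (F + G)) ->
  (forall F G, P F -> P G -> P (F * G)) -> forall F, P F.
Proof.
move=> PC PX PD PM; apply: mpolyind => [|c m F _ _ PF].
  by rewrite -mpolyC0; exact: PC.
apply: (PD _ _ _ PF); rewrite -mul_mpolyC mpolyXE_id.
apply: (PM _ _ (PC c)); apply: big_ind => [||i _].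
- by rewrite -mpolyC1; exact: PC.
- exact: PM.
- by elim: (m i) => [|k IH]; rewrite ?expr0 ?exprS; [rewrite -mpolyC1|exact: PM].
Qed.

Definition line_restriction u w F : {poly K} :=
  mmap (@polyC K) (fun i => (u i)%:P + (w i)%:P * 'X) F.

Lemma horner_line_restriction u w F t :
  (line_restriction u w F).[t] = F.@[fun i => u i + t * w i].
Proof.
elim/mpoly_ring_ind: F => [c|i|F G IF IG|F G IF IG]; rewrite /line_restriction.
- by rewrite mmapC hornerC mevalC.
- by rewrite mmapX mmap1U mevalXU !hornerE mulrC.
- by rewrite mmapD hornerD mevalD -IF -IG.
- by rewrite rmorphM hornerM mevalM -IF -IG.
Qed.

Lemma size_line_restriction u w F : (size (line_restriction u w F) <= msize F)%N.
Proof.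
rewrite /line_restriction /mmap big_seq; apply: (leq_trans (size_sum _ _ _)).
apply/bigmax_leqP_seq => m _ mF; apply: leq_trans (msize_mdeg_lt mF).
rewrite mul_polyC; apply: (leq_trans (size_scale_leq _ _)).
rewrite /mmap1 mdegE.
apply: (big_ind2 (fun (p : {poly K}) k => (size p <= k.+1)%N)) => [|p k q l Hp Hq|i _].
- by rewrite size_poly1.
- by apply: (leq_trans (size_polyMleq _ _)); lia.
apply: (leq_trans (size_poly_exp_leq _ _)); rewrite ltnS.
have: (size ((u i)%:P + (w i)%:P * 'X)%R <= 2)%N.
  by rewrite addrC size_MXaddC; case: ifP => // _; rewrite ltnS size_polyC_leq1.
by case: (size _) => [|[|[|k]]] //= _; rewrite ?mul0n ?mul1n.
Qed.

Lemma deriv_line_restriction u w F :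
  (line_restriction u w F)^`() =
    \sum_i w i *: line_restriction u w F^`M(i).
Proof.
elim/mpoly_ring_ind: F => [c|i|F G IF IG|F G IF IG]; rewrite /line_restriction.
- by rewrite mmapC derivC big1 // => i _; rewrite mderivC mmap0 scaler0.
- rewrite mmapX mmap1U derivD derivC add0r derivM derivC mul0r add0r derivX mulr1.
  rewrite (bigD1 i) //= big1 ?addr0 => [|j ji]; rewrite mderivX mnm1E.
    rewrite eqxx scale1r; have -> : (U_(i) - U_(i))%MM = 0%MM :> 'X_{1..n}.
      by apply/mnmP => k; rewrite mnmE subnn mnm0E.
    by rewrite mpolyX0 rmorph1 alg_polyC.
  by rewrite eq_sym (negPf ji) scale0r mmap0 scaler0.
- rewrite mmapD derivD IF IG -big_split /=; apply: eq_bigr => i _.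
  by rewrite mderivD mmapD scalerDr.
- rewrite rmorphM derivM IF IG mulr_suml mulr_sumr -big_split /=.
  apply: eq_bigr => i _; rewrite mderivM mmapD !rmorphM scalerDr.
  by rewrite scalerAl scalerAr.
Qed.

Lemma poly_eq0_natr (p : {poly K}) :
  (forall j, p.[j.+1%:R] = 0) -> p = 0.
Proof.
move=> p0; apply/eqP/negPn/negP => pn0.
have := max_poly_roots (rs := [seq j.+1%:R | j <- iota 0 (size p)]) pn0.
rewrite size_map size_iota ltnn => H; apply: notF; apply: H.
  by apply/allP => _ /mapP[j _ ->]; rewrite /root p0.
rewrite map_inj_uniq ?iota_uniq // => i j /eqP.
by rewrite eqr_nat => /eqP[].
Qed.

Lemma line_restriction_eq0 u w F : (forall v, F.@[v] = 0) -> line_restriction u w F = 0.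
Proof. by move=> F0; apply: poly_eq0_natr => j; rewrite horner_line_restriction. Qed.

(** Restricting to lines parallel to the axes shows that the partial derivatives
of a function that vanishes everywhere vanish everywhere too; in characteristic
zero the coefficients of [F] are recovered from values of iterated
derivatives. *)
Lemma mpoly_eq0_meval F : (forall v, F.@[v] = 0) -> F = 0.
Proof.
move=> F0; apply/mpolyP => m; rewrite mcoeff0.
elim: {m}(mdeg m) {-2}m (erefl (mdeg m)) F F0 => [|d IH] m.
  move=> /eqP; rewrite mdeg_eq0 => /eqP -> F F0.
  rewrite -[RHS](F0 (fun=> 0)).
  elim/mpoly_ring_ind: F {F0} => [c|i|F G IF IG|F G IF IG].
  - by rewrite mcoeffC eqxx mulr1 mevalC.
  - by rewrite mcoeffX mevalXU mnm1_eq0.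
  - by rewrite mcoeffD mevalD IF IG.
  - by rewrite mevalM -IF -IG; have [-> _] := @mcoeff0_is_multiplicative n K.
move=> dm F F0.
have [i mi] : exists i, m i != 0%N.
  apply/existsP; rewrite -negb_forall; apply/negP => /forallP m0.
  by move: dm; rewrite mdegE big1 // => i _; apply/eqP/m0.
have mE : m = (m - U_(i) + U_(i))%MM.
  apply/mnmP => j; rewrite !mnmE; case: eqP => [<-|] /=; first by rewrite subnK ?lt0n.
  by rewrite subn0 addn0.
have dF v : (F^`M(i)).@[v] = 0.
  have := deriv_line_restriction v (fun j => (j == i)%:R) F.
  rewrite line_restriction_eq0 // derivC => /(congr1 (fun p => p.[0])).
  rewrite horner0 horner_sum (bigD1 i) //= big1 => [|j ji]; last first.
    by rewrite (negPf ji) scale0r horner0.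
  rewrite eqxx scale1r addr0 horner_line_restriction => ->.
  by apply: meval_eq => j; rewrite mul0r addr0.
have := IH (m - U_(i))%MM _ _ dF.
rewrite mcoeff_mderiv -mE => /(_ _)/eqP; rewrite mulrn_eq0 /= => H; apply/eqP/H.
by move: dm; rewrite {1}mE mdegD mdeg1 addn1 => -[].
Qed.

Definition linear_form (c : 'rV[K]_n) : {mpoly K[n]} := \sum_i c 0 i *: 'X_i.

Lemma meval_linear_form c v : (linear_form c).@[v] = \sum_i c 0 i * v i.
Proof. by rewrite /linear_form raddf_sum /=; apply: eq_bigr => i _; rewrite mevalZ mevalXU. Qed.

Lemma mcoeff_linear_form c i : (linear_form c)@_(U_(i)) = c 0 i.
Proof.
rewrite /linear_form raddf_sum /= (bigD1 i) //= big1 => [|j ji].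
  by rewrite mcoeffZ mcoeffX eqxx mulr1 addr0.
by rewrite mcoeffZ mcoeffX eq_mnm1 (negPf ji) mulr0.
Qed.

Lemma linear_form_eq0 c : (linear_form c == 0) = (c == 0).
Proof.
apply/eqP/eqP => [L0|->].
  by apply/rowP => i; rewrite -mcoeff_linear_form L0 mcoeff0 mxE.
by rewrite /linear_form big1 // => i _; rewrite mxE scale0r.
Qed.

Lemma dhomog_linear_form c : linear_form c \is 1.-homog.
Proof.
by apply: rpred_sum => i _; apply: rpredZ; rewrite dhomogX; apply/eqP/mdeg1.
Qed.

(** The substitution [x_i := x_i - l / c_i], where [l] is the linear form and
[c_i] a nonzero coefficient of it, changes [F] by a multiple of [l], and it
projects the whole space onto the zero set of [l], where [F] vanishes. *)
Lemma linear_form_factor c F : c != 0 ->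
  (forall v, (linear_form c).@[v] = 0 -> F.@[v] = 0) ->
  exists G, F = linear_form c * G.
Proof.
move=> /rV0Pn[i ci] F0.
pose s := [tuple 'X_j - (j == i)%:R * (c 0 i)^-1 *: linear_form c | j < n].
have FsF G : exists H, G - (G \mPo s) = linear_form c * H.
  elim/mpoly_ring_ind: G => [a|j|G1 G2 [H1 E1] [H2 E2]|G1 G2 [H1 E1] [H2 E2]].
  - by exists 0; rewrite comp_mpolyC subrr mulr0.
  - exists ((j == i)%:R * (c 0 i)^-1)%:MP.
    rewrite comp_mpolyXU -tnth_nth tnth_mktuple.
    by rewrite opprB addrC subrK -mul_mpolyC mulrC.
  - by exists (H1 + H2); rewrite comp_mpolyD opprD addrACA E1 E2 mulrDr.
  - exists (H1 * G2 + (G1 \mPo s) * H2).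
    rewrite rmorphM /= mulrDr mulrA -E1 mulrCA -E2; ring.
have Fs0 : F \mPo s = 0.
  apply: mpoly_eq0_meval => v; rewrite comp_mpoly_meval; apply: F0.
  rewrite meval_linear_form.
  under eq_bigr => j _ do rewrite tnth_mktuple mevalB mevalXU mevalZ mulrBr.
  rewrite sumrB [X in _ - X](bigD1 i) //= [X in _ - (_ + X)]big1 => [|j ji].
    by rewrite eqxx mul1r mulrA divff // mul1r addr0 meval_linear_form subrr.
  by rewrite (negPf ji) !mul0r mulr0.
by have [H] := FsF F; rewrite Fs0 subr0; exists H.
Qed.

End PolynomialEvaluation.

(** * Rigidity of tangent fields *)

Section Rigidity.
Variables (K : numFieldType) (n : nat).
Implicit Types (F G : {mpoly K[n]}) (p q : 'rV[K]_n).

Definition dot (c p : 'rV[K]_n) : K := \sum_i c 0 i * p 0 i.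

Lemma meval_linear_form_dot c p : (linear_form c).@[p 0] = dot c p.
Proof. exact: meval_linear_form. Qed.

Lemma dotD c p q : dot c (p + q) = dot c p + dot c q.
Proof. by rewrite /dot -big_split; apply: eq_bigr => i _; rewrite mxE mulrDr. Qed.

Lemma dotZ c a p : dot c (a *: p) = a * dot c p.
Proof. by rewrite /dot mulr_sumr; apply: eq_bigr => i _; rewrite mxE mulrCA. Qed.

Definition parallel (c q : 'rV[K]_n) : bool := [forall a, forall b, c 0 a * q 0 b == c 0 b * q 0 a].

Lemma parallelP (c q : 'rV[K]_n) : reflect (forall a b, c 0 a * q 0 b = c 0 b * q 0 a) (parallel c q).
Proof.
apply: (iffP forallP) => H a; last by apply/forallP => b; apply/eqP.
by move=> b; apply/eqP; move: b; apply/forallP.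
Qed.

Lemma parallel_sym c q : parallel c q = parallel q c.
Proof.
by apply/parallelP/parallelP => H a b; rewrite mulrC H mulrC.
Qed.

Lemma dot_delta c a : dot c (delta_mx 0 a) = c 0 a.
Proof.
rewrite /dot (bigD1 a) //= big1 => [|i ia]; first by rewrite mxE !eqxx mulr1 addr0.
by rewrite mxE eqxx (negPf ia) mulr0.
Qed.

Lemma not_parallel_witness c c' : ~~ parallel c c' ->
  exists2 q, dot c q = 0 & dot c' q != 0.
Proof.
rewrite negb_forall => /existsP[a]; rewrite negb_forall => /existsP[b ab].
exists (c 0 b *: delta_mx 0 a + (- c 0 a) *: delta_mx 0 b).
  by rewrite dotD !dotZ !dot_delta; ring.
rewrite dotD !dotZ !dot_delta; apply: contra ab => /eqP H; apply/eqP.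
by apply: subr0_eq; rewrite -[RHS]oppr0 -H; ring.
Qed.

Lemma horner_line_restriction_row p q F t :
  (line_restriction (p 0) (q 0) F).[t] = F.@[(p + t *: q) 0].
Proof.
by rewrite horner_line_restriction; apply: meval_eq => i; rewrite !mxE.
Qed.

Lemma meval_eq0_limit F p q :
  (forall j, F.@[(p + j.+1%:R *: q) 0] = 0) -> F.@[p 0] = 0.
Proof.
move=> F0; have := horner_line_restriction_row p q F 0.
rewrite scale0r addr0 => <-.
suff -> : line_restriction (p 0) (q 0) F = 0 by rewrite horner0.
by apply: poly_eq0_natr => j; rewrite horner_line_restriction_row.
Qed.

(** On the hyperplane of [c], the form [c'] is nonzero in some direction [q];
along each line of direction [q] the product restricts to a product of two
univariate polynomials, one of which is nonzero. *)
Lemma vanish_cancel c c' F : ~~ parallel c c' ->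
    (forall p, dot c p = 0 -> F.@[p 0] * dot c' p = 0) ->
  forall p, dot c p = 0 -> F.@[p 0] = 0.
Proof.
move=> /not_parallel_witness[q cq c'q] F0 p cp.
have /eqP : line_restriction (p 0) (q 0) F
          * ((dot c' p)%:P + (dot c' q)%:P * 'X) = 0.
  apply: poly_eq0_natr => j; rewrite hornerM horner_line_restriction_row !hornerE.
  by rewrite [dot c' q * _]mulrC -dotZ -dotD F0 // dotD dotZ cp cq mulr0 addr0.
rewrite mulf_eq0 => /orP[/eqP P0|/eqP/(congr1 (coefp 1))].
  have := horner_line_restriction_row p q F 0.
  by rewrite P0 horner0 scale0r addr0.
rewrite /= coefD coefC coefCM coefX /= add0r mulr1 coef0 => /eqP.
by rewrite (negPf c'q).
Qed.

(** A binary form of degree [N] with [N + 1] zeros on the projective line is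
zero; here [F] is only bounded in degree, but vanishes on the cones over the
points [e] and [f + c e].  The line [m e + t q], for a vector [q] of the plane
and [m != 0], meets all these cones for distinct values of [t], unless [q] lies
on one of them. *)
Lemma vanish_on_plane F (e f : 'rV[K]_n) (cs : seq K) :
    uniq cs -> (msize F <= (size cs).+1)%N ->
    (forall a, F.@[(a *: e) 0] = 0) ->
    (forall a (c : K), c \in cs -> F.@[(a *: (f + c *: e)) 0] = 0) ->
  forall a b, F.@[(a *: e + b *: f) 0] = 0.
Proof.
move=> cs_uniq sF Fe Ff a b.
have [->|b0] := eqVneq b 0; first by rewrite scale0r addr0.
have [cs_ab|cs_ab] := boolP (a / b \in cs).
  suff -> : a *: e + b *: f = b *: (f + (a / b) *: e) by apply: Ff.
  by rewrite scalerDr scalerA mulrCA divff // mulr1 addrC.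
set q := a *: e + b *: f.
(* The argument needs a nonzero multiple of [e]; [q] itself is the limit case. *)
apply: (meval_eq0_limit (q := e)) => j; set m : K := j.+1%:R.
have m0 : m != 0 by rewrite pnatr_eq0.
rewrite addrC.
have P0 : line_restriction ((m *: e) 0) (q 0) F = 0.
  apply/eqP/negPn/negP => Pn0.
  pose rs := 0 :: [seq m / (c * b - a) | c <- cs].
  have dn0 c : c \in cs -> c * b - a != 0.
    move=> ccs; apply: contra cs_ab; rewrite subr_eq0 => /eqP <-.
    by rewrite mulfK.
  suff /(max_poly_roots Pn0) : all (root (line_restriction ((m *: e) 0) (q 0) F)) rs.
    rewrite /= size_map => H; have /H : uniq rs; last first.
      by rewrite ltnNge (leq_trans (size_line_restriction _ _ _) sF).
    rewrite /= map_inj_in_uniq ?cs_uniq ?andbT.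
      apply/mapP => -[c /dn0 c0] /esym/eqP.
      by rewrite mulf_eq0 invr_eq0 (negPf m0) (negPf c0).
    move=> c c' /dn0 c0 /dn0 c'0 /(mulfI m0)/invr_inj/addIr.
    exact: mulIf.
  apply/allP => t; rewrite inE => /predU1P[->|/mapP[c ccs ->]]; rewrite /root.
    by rewrite horner_line_restriction_row scale0r addr0 Fe.
  rewrite horner_line_restriction_row; apply/eqP.
  have c0 := dn0 c ccs; set s := m / _.
  suff -> : m *: e + s *: q = (s * b) *: (f + c *: e) by apply: Ff.
  rewrite /q !scalerDr !scalerA addrA -scalerDl [RHS]addrC; congr (_ *: _ + _).
  by rewrite /s; field.
have := horner_line_restriction_row (m *: e) q F 1.
by rewrite P0 horner0 scale1r.
Qed.

(** The triples [W] that are tested arise as the cross product of a vector field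
with the position vector.  Proportionality to the coefficients of [l i] along
the line [l i] then expresses tangency, and the field is a multiple of the Euler
field exactly when [W = 0].  The bound [N.+1] on [msize] means degree at most
[N]. *)
Definition rigid (l : nat -> 'rV[K]_n) (D N : nat) : Prop :=
  forall W : 'I_n -> {mpoly K[n]}, (forall a, msize (W a) <= N.+1)%N ->
    (forall i, (i < D)%N -> forall p, dot (l i) p = 0 ->
       forall a b, (W a).@[p 0] * l i 0 b = (W b).@[p 0] * l i 0 a) ->
  forall a, W a = 0.

Lemma rigidS l D N : rigid l D N -> rigid l D.+1 N.
Proof. by move=> lDN W sW W0; apply: lDN => // i iD; apply: W0; rewrite ltnS ltnW. Qed.

Lemma parallel_both (w c c' : 'rV[K]_n) : ~~ parallel c c' ->
  parallel w c -> parallel w c' -> w = 0.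
Proof.
rewrite negb_forall => /existsP[a]; rewrite negb_forall => /existsP[b ab].
move=> /parallelP wc /parallelP wc'; apply/rowP => k; rewrite mxE.
apply: (mulIf (x := c 0 a * c' 0 b - c 0 b * c' 0 a)); first by rewrite subr_eq0.
rewrite mul0r mulrBr !mulrA (wc k a) (wc k b).
by rewrite mulrAC (wc' a b) mulrAC subrr.
Qed.

Lemma rigid2 l : ~~ parallel (l 0%N) (l 1%N) -> rigid l 2 0.
Proof.
move=> l01 W sW W0 a.
have WC b : W b = ((W b)@_0)%:MP by apply: msize1_polyC.
have dot0 c : dot c 0 = 0 by rewrite /dot big1 // => i _; rewrite mxE mulr0.
have := @parallel_both (\row_b (W b)@_0) _ _ l01.
have Wl i : (i < 2)%N -> parallel (\row_b (W b)@_0) (l i).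
  move=> i2; apply/parallelP => b b'; rewrite !mxE.
  by have := W0 i i2 0 (dot0 _) b b'; rewrite (WC b) (WC b') !mevalC !mcoeffC !eqxx !mulr1.
move=> /(_ (Wl 0%N isT) (Wl 1%N isT))/rowP/(_ a).
by rewrite !mxE => W00; rewrite WC W00 mpolyC0.
Qed.

(** The plane over the new line is spanned by [e] and [f]; its points on earlier
lines are given in the form [e] or [f + c e], at least [N + 2] in all.  Both
proportionality conditions make [W] vanish there, hence on the whole line, and
dividing by the equation of the line lowers the degree without losing the
conditions for the earlier lines. *)
Lemma rigid_step l D N (e f : 'rV[K]_n) (cs : seq K) :
    rigid l D N ->
    l D != 0 -> (forall i, (i < D)%N -> ~~ parallel (l i) (l D)) ->
    (forall p, dot (l D) p = 0 -> exists a b, p = a *: e + b *: f) ->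
    dot (l D) e = 0 -> dot (l D) f = 0 ->
    uniq cs -> (N < size cs)%N ->
    (exists2 i, (i < D)%N & dot (l i) e = 0) ->
    (forall c : K, c \in cs -> exists2 i, (i < D)%N & dot (l i) (f + c *: e) = 0) ->
  rigid l D.+1 N.+1.
Proof.
move=> lDN lD0 lDP plane De Df cs_uniq Ncs [ie ieD dote] dotf W sW W0.
have common i p : (i < D)%N -> dot (l i) p = 0 -> dot (l D) p = 0 ->
    forall a, (W a).@[p 0] = 0.
  move=> iD ip Dp a.
  have par j : (j < D.+1)%N -> dot (l j) p = 0 ->
      parallel (\row_b (W b).@[p 0]) (l j).
    by move=> jD jp; apply/parallelP => b b'; rewrite !mxE W0.
  have /rowP/(_ a) := parallel_both (lDP i iD) (par i (ltnW iD) ip) (par D (ltnSn D) Dp).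
  by rewrite !mxE.
have WD a p : dot (l D) p = 0 -> (W a).@[p 0] = 0.
  move=> /plane[x [y ->]]; apply: (vanish_on_plane cs_uniq).
  - by apply: leq_trans (sW a) _.
  - by move=> z; apply: (common ie) => //; rewrite dotZ ?dote ?De mulr0.
  - move=> z c /dotf[i iD ic]; apply: (common i) => //; rewrite dotZ ?ic ?mulr0 //.
    by rewrite dotD dotZ De Df mulr0 addr0 mulr0.
have /choice[V VE] : forall a, exists G, W a = linear_form (l D) * G.
  move=> a; apply: linear_form_factor => // v.
  rewrite (_ : (linear_form _).@[v] = dot (l D) (\row_i v i)); last first.
    by rewrite meval_linear_form; apply: eq_bigr => i _; rewrite mxE.
  by move=> /(WD a) <-; apply: meval_eq => i; rewrite mxE.
have lf0 : linear_form (l D) != 0 by rewrite linear_form_eq0.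
have slf : msize (linear_form (l D)) = 2.
  have := dhomog_msize (dhomog_linear_form (l D)).
  move=> /(dhomog_uniq lf0 (dhomog_linear_form (l D))).
  by have := msize_poly_eq0 (linear_form (l D)); rewrite (negPf lf0); lia.
have V0 : forall a, V a = 0; last by move=> a; rewrite VE V0 mulr0.
apply: lDN => [a|i iD p ip a b].
  have [->|V0] := eqVneq (V a) 0; first by rewrite msize0.
  by have := sW a; rewrite VE msizeM // slf.
apply: subr0_eq.
pose G := V a * (l i 0 b)%:MP - V b * (l i 0 a)%:MP.
have := @vanish_cancel (l i) (l D) G (lDP i iD) _ p ip.
rewrite /G mevalB !mevalM !mevalC; apply => q iq.
have := W0 i (ltnW iD) q iq a b; rewrite !VE !mevalM meval_linear_form_dot => H.
rewrite mevalB !mevalM !mevalC mulrBl; apply/eqP; rewrite subr_eq0; apply/eqP.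
by rewrite mulrAC [_ * dot _ _]mulrC H; ring.
Qed.

End Rigidity.

(** * Jacobian syzygies *)

Section Derivations.
Variables (K : numFieldType) (n : nat).
Implicit Types (F G : {mpoly K[n]}).

Definition derivation (a : 'I_n -> {mpoly K[n]}) F : {mpoly K[n]} :=
  \sum_i a i * F^`M(i).

Lemma derivationM a F G :
  derivation a (F * G) = derivation a F * G + F * derivation a G.
Proof.
rewrite /derivation mulr_suml mulr_sumr -big_split /=; apply: eq_bigr => i _.
by rewrite mderivM; ring.
Qed.

Lemma mderiv_linear_form (c : 'rV[K]_n) i : (linear_form c)^`M(i) = (c 0 i)%:MP.
Proof.
rewrite /linear_form raddf_sum /= (bigD1 i) //= big1 => [|j ji].
  rewrite mderivZ mderivX mnm1E eqxx scale1r.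
  have -> : (U_(i) - U_(i))%MM = 0%MM :> 'X_{1..n}.
    by apply/mnmP => k; rewrite mnmE subnn mnm0E.
  by rewrite mpolyX0 addr0 -mul_mpolyC mulr1.
by rewrite mderivZ mderivX mnm1E (negPf ji) scale0r scaler0.
Qed.

Lemma euler_prod (I : Type) (s : seq I) (l : I -> 'rV[K]_n) :
  derivation (fun i => 'X_i) (\prod_(i <- s) linear_form (l i)) =
    (size s)%:R * \prod_(i <- s) linear_form (l i).
Proof.
elim: s => [|i s IH].
  by rewrite big_nil mul0r /derivation big1 // => i _; rewrite -mpolyC1 mderivC mulr0.
rewrite big_cons derivationM IH /= [in RHS]mulrSr.
suff -> : derivation (fun i => 'X_i) (linear_form (l i)) = linear_form (l i) by ring.
apply: eq_bigr => j _; rewrite mderiv_linear_form -mul_mpolyC; exact: mulrC.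
Qed.

Lemma dhomog_mderiv m F i : F \is m.+1.-homog -> F^`M(i) \is m.-homog.
Proof.
move=> /dhomogP HF; apply/dhomogP => k.
rewrite mcoeff_msupp mcoeff_mderiv mulrn_eq0 /= -mcoeff_msupp => /HF /=.
by rewrite mdegD mdeg1 addn1 => -[].
Qed.

Lemma vanish_cancel_prod (I : Type) (s : seq I) (P : pred I) (l : I -> 'rV[K]_n)
    (c : 'rV[K]_n) F :
    (forall i, P i -> ~~ parallel c (l i)) ->
    (forall p, dot c p = 0 -> F.@[p 0] * (\prod_(i <- s | P i) linear_form (l i)).@[p 0] = 0) ->
  forall p, dot c p = 0 -> F.@[p 0] = 0.
Proof.
move=> lP; elim: s => [|i s IH] F0.
  by move=> p /F0; rewrite big_nil meval1 mulr1.
apply: IH; move: F0; rewrite big_cons; case: ifP => // Pi F0 p cp.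
rewrite -mevalM; apply: (vanish_cancel (lP i Pi)) cp => q /F0.
by rewrite !mevalM meval_linear_form_dot mulrCA mulrC.
Qed.
End Derivations.

Local Notation o0 := (@Ordinal 3 0 isT).
Local Notation o1 := (@Ordinal 3 1 isT).
Local Notation o2 := (@Ordinal 3 2 isT).

Lemma ord3_ind (P : 'I_3 -> Prop) : P o0 -> P o1 -> P o2 -> forall i, P i.
Proof.
by move=> P0 P1 P2 [[|[|[|m]]] Hm] //; rewrite (bool_irrelevance Hm isT).
Qed.

Lemma sum3E (V : nmodType) (F : 'I_3 -> V) : \sum_i F i = F o0 + F o1 + F o2.
Proof.
rewrite !big_ord_recl big_ord0 addr0 addrA.
by congr (F _ + F _ + F _); apply: val_inj.
Qed.

Section Syzygies.
Variables (K : numFieldType) (d : nat) (l : nat -> 'rV[K]_3).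
Hypothesis l_neq0 : forall i, (i < d)%N -> l i != 0.
Hypothesis l_npar : forall i j, (i < d)%N -> (j < d)%N -> i != j -> ~~ parallel (l i) (l j).

Let A (i : 'I_d) := linear_form (l i).

Lemma defining_poly_neq0 : defining_poly A != 0.
Proof. by apply/prodf_neq0 => i _; rewrite linear_form_eq0 l_neq0. Qed.

(** Let [f] be the product of the [i]-th form and a cofactor.  The Leibniz rule
shows that the derivative of the [i]-th form times the cofactor vanishes along
the [i]-th line, and the cofactor can be cancelled because none of its factors
is proportional to the [i]-th form. *)
Lemma syzygy_tangent a (i : nat) (p : 'rV[K]_3) : (i < d)%N ->
  \sum_(k < 3) a k * (defining_poly A)^`M(k) = 0 -> dot (l i) p = 0 ->
  \sum_k (a k).@[p 0] * l i 0 k = 0.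
Proof.
move=> id a0 ip.
have -> : \sum_k (a k).@[p 0] * l i 0 k = (derivation a (linear_form (l i))).@[p 0].
  rewrite /derivation raddf_sum /=; apply: eq_bigr => k _.
  by rewrite mevalM mderiv_linear_form mevalC.
apply: (@vanish_cancel_prod _ _ _ (index_enum 'I_d)
          (fun j => j != Ordinal id) (fun j : 'I_d => l j) (l i)) ip.
  by move=> j ji; apply: l_npar => //; rewrite eq_sym.
move=> q iq; have := congr1 (meval (q 0)) a0.
rewrite -/(derivation a _) /defining_poly (bigD1 (Ordinal id)) //=.
rewrite derivationM mevalD !mevalM meval0 [X in _ + X * _]meval_linear_form_dot iq.
by rewrite mul0r addr0.
Qed.

(** If the cross product [W] of a syzygy [a] with the position vector is zero,
then [a] is proportional to the Euler field, and the Euler identity turns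
[a . grad f = 0] into [d f a = 0]. *)
Lemma rigid_syzygy_degree r s : (0 < d)%N -> rigid l d r ->
  has_jacobian_syzygy (defining_poly A) s -> (r <= s)%N.
Proof.
move=> d0 lr [a [ah [i0 ai0] a0]]; rewrite leqNgt; apply/negP => sr.
pose W (i : 'I_3) : {mpoly K[3]} := match val i with
  | 0 => a o1 * 'X_o2 - a o2 * 'X_o1
  | 1 => a o2 * 'X_o0 - a o0 * 'X_o2
  | _ => a o0 * 'X_o1 - a o1 * 'X_o0 end.
have sX i j : (msize (a i * 'X_j) <= r.+1)%N.
  have [->|n0] := eqVneq (a i) 0; first by rewrite mul0r msize0.
  rewrite msizeM // -?msize_poly_eq0 ?msizeX // mdeg1 addn2 /= ltnS.
  apply: leq_trans _ sr; have := dhomog_uniq n0 (ah i) (dhomog_msize (ah i)).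
  by move=> ->; exact: leqSpred.
have sXB i j i' j' : (msize (a i * 'X_j - a i' * 'X_j') <= r.+1)%N.
  by apply: leq_trans (msizeD_le _ _) _; rewrite msizeN geq_max !sX.
have W0 : forall i, W i = 0.
  apply: lr => [|i id p ip].
    by elim/ord3_ind; rewrite /W /=; apply: sXB.
  have := syzygy_tangent id a0 ip; rewrite sum3E => t0.
  move: ip; rewrite /dot sum3E => ip.
  have W01 : (W o0).@[p 0] * l i 0 o1 = (W o1).@[p 0] * l i 0 o0.
    rewrite /W /= !mevalB !mevalM !mevalXU; apply: subr0_eq.
    transitivity (p 0 o2 * 0 - (a o2).@[p 0] * 0); last by ring.
    by rewrite -{1}t0 -ip; ring.
  have W02 : (W o0).@[p 0] * l i 0 o2 = (W o2).@[p 0] * l i 0 o0.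
    rewrite /W /= !mevalB !mevalM !mevalXU; apply: subr0_eq.
    transitivity ((a o1).@[p 0] * 0 - p 0 o1 * 0); last by ring.
    by rewrite -{1}ip -t0; ring.
  have W12 : (W o1).@[p 0] * l i 0 o2 = (W o2).@[p 0] * l i 0 o1.
    rewrite /W /= !mevalB !mevalM !mevalXU; apply: subr0_eq.
    transitivity (p 0 o0 * 0 - (a o0).@[p 0] * 0); last by ring.
    by rewrite -{1}t0 -ip; ring.
  by elim/ord3_ind; elim/ord3_ind.
have aX i j : a i * 'X_j = a j * 'X_i.
  have := W0 o0; have := W0 o1; have := W0 o2; rewrite /W /=.
  move=> /subr0_eq H2 /subr0_eq H1 /subr0_eq H0.
  by move: i j; elim/ord3_ind; elim/ord3_ind.
have := euler_prod (index_enum 'I_d) (fun i : 'I_d => l i).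
have -> : size (index_enum 'I_d) = d by rewrite -[RHS](size_enum_ord d) enumT.
rewrite -/(defining_poly A) => E.
have : a i0 * (d%:R * defining_poly A) = 0.
  rewrite -E; transitivity ('X_i0 * (\sum_(k < 3) a k * (defining_poly A)^`M(k))).
    rewrite /derivation !mulr_sumr; apply: eq_bigr => k _.
    by rewrite !mulrA aX [a k * _]mulrC.
  by rewrite a0 mulr0.
move/eqP; rewrite !mulf_eq0 (negPf ai0) (negPf defining_poly_neq0) orbF /=.
by rewrite -[d%:R]mpolyC_nat mpolyC_eq0 pnatr_eq0; lia.
Qed.

(** Let [g] be the product of the forms of the lines through [(0 : 1 : 0)], which
do not involve [y], and [h] the product of the others.  The field
[h d/dy - (1/d) (dh/dy) E], with [E] the Euler field, kills [f = g h].  It is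
nonzero: if [dh/dy = 0] its [y]-component is [h], and otherwise its
[x]-component is nonzero. *)
Lemma pencil_syzygy (k : nat) :
  (k < d)%N -> #|[pred i : 'I_d | l i 0 o1 == 0]| = k ->
  has_jacobian_syzygy (defining_poly A) (d - k).
Proof.
move=> kd Bk; pose B (i : 'I_d) := l i 0 o1 == 0.
pose g := \prod_(i | B i) A i; pose h := \prod_(i | ~~ B i) A i.
have fE : defining_poly A = g * h by rewrite /defining_poly (bigID B).
have h0 : h != 0 by apply/prodf_neq0 => i _; rewrite linear_form_eq0 l_neq0.
have g1 : g^`M(o1) = 0.
  apply: (big_ind (fun F : {mpoly K[3]} => F^`M(o1) = 0)) => [|F G F1 G1|i /eqP i1].
  - by rewrite -mpolyC1 mderivC.
  - by rewrite mderivM F1 G1 mul0r mulr0 addr0.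
  - by rewrite mderiv_linear_form i1 mpolyC0.
have hh : h \is (d - k).-homog.
  have -> : (d - k)%N = #|[pred i | ~~ B i]|.
    have := cardC B; rewrite card_ord => dE.
    apply/eqP; rewrite -(eqn_add2l k) subnKC ?(ltnW kd) // -{1}dE -Bk.
    by apply/eqP; congr (_ + _)%N; apply: eq_card.
  rewrite /h -sum1_card.
  apply: (big_ind2 (fun (F : {mpoly K[3]}) m => F \is m.-homog)) => [|F m G m' Fm Gm|i _].
  - exact: dhomog1.
  - exact: dhomogM.
  - exact: dhomog_linear_form.
pose c : K := d%:R^-1.
have d0 : d%:R != 0 :> K by rewrite pnatr_eq0; lia.
exists (fun j => (if j == o1 then h else 0) - c *: ('X_j * h^`M(o1))); split.
- move=> j; apply: rpredB; first by case: ifP => // _; apply: rpred0.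
  apply: rpredZ; have [m dk] : exists m, (d - k)%N = m.+1 by exists (d - k).-1; lia.
  rewrite dk -[m.+1]add1n; apply: dhomogM; first by rewrite dhomogX; apply/eqP/mdeg1.
  by apply: dhomog_mderiv; rewrite -dk.
- have [h1|h1] := eqVneq h^`M(o1) 0.
    by exists o1; rewrite eqxx h1 mulr0 scaler0 subr0.
  exists o0; rewrite /= sub0r oppr_eq0 scaler_eq0 invr_eq0 (negPf d0) /=.
  by rewrite mulf_neq0 // -msize_poly_eq0 msizeX.
have E := euler_prod (index_enum 'I_d) (fun i : 'I_d => l i).
move: E; have -> : size (index_enum 'I_d) = d by rewrite -[RHS](size_enum_ord d) enumT.
rewrite -/(defining_poly A) => E.
under eq_bigr do rewrite mulrBl -scalerAl mulrAC.
rewrite sumrB -scaler_sumr -mulr_suml -/(derivation (fun j => 'X_j) _) E.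
rewrite (bigD1 o1) //= big1 => [|j /negPf->]; last by rewrite mul0r.
rewrite addr0 fE mderivM g1 mul0r add0r -[d%:R]mpolyC_nat -!mulrA mul_mpolyC scalerA.
by rewrite /c mulVf // scale1r; ring.
Qed.
End Syzygies.

(** * The Tjurina number of a growing arrangement *)

Section Points.
Variable K : numFieldType.
Implicit Types u v w : 'rV[K]_3.

Definition cross u v : 'rV[K]_3 := \row_i match val i with
  | 0 => u 0 o1 * v 0 o2 - u 0 o2 * v 0 o1
  | 1 => u 0 o2 * v 0 o0 - u 0 o0 * v 0 o2
  | _ => u 0 o0 * v 0 o1 - u 0 o1 * v 0 o0 end.

Lemma dot_crossl u v : dot u (cross u v) = 0.
Proof. by rewrite /dot sum3E !mxE /=; ring. Qed.

Lemma dot_crossr u v : dot v (cross u v) = 0.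
Proof. by rewrite /dot sum3E !mxE /=; ring. Qed.

Lemma cross_eq0 u v : cross u v = 0 -> parallel u v.
Proof.
move=> /rowP c0; apply/parallelP.
have := c0 o0; have := c0 o1; have := c0 o2; rewrite !mxE /=.
move=> /subr0_eq c2 /subr0_eq c1 /subr0_eq c3.
by elim/ord3_ind; elim/ord3_ind.
Qed.

Lemma parallel_cross u v w : dot u w = 0 -> dot v w = 0 -> parallel w (cross u v).
Proof.
rewrite /dot !sum3E => uw vw; apply/parallelP.
have E01 : w 0 o0 * cross u v 0 o1 = w 0 o1 * cross u v 0 o0.
  rewrite !mxE /=; apply: subr0_eq; transitivity (u 0 o2 * 0 - v 0 o2 * 0); last by ring.
  by rewrite -{1}vw -uw; ring.
have E02 : w 0 o0 * cross u v 0 o2 = w 0 o2 * cross u v 0 o0.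
  rewrite !mxE /=; apply: subr0_eq; transitivity (v 0 o1 * 0 - u 0 o1 * 0); last by ring.
  by rewrite -{1}uw -vw; ring.
have E12 : w 0 o1 * cross u v 0 o2 = w 0 o2 * cross u v 0 o1.
  rewrite !mxE /=; apply: subr0_eq; transitivity (u 0 o0 * 0 - v 0 o0 * 0); last by ring.
  by rewrite -{1}vw -uw; ring.
by elim/ord3_ind; elim/ord3_ind.
Qed.

Lemma vline_parallel u v : u != 0 -> v != 0 -> (<[u]>%VS == <[v]>%VS) = parallel u v.
Proof.
move=> u0 v0; apply/eqP/parallelP => [uv a b|uv].
  have := memv_line u; rewrite uv => /vlineP[k ->]; rewrite !mxE; ring.
have /rV0Pn[a va] := v0.
have uE : u = (u 0 a / v 0 a) *: v.
  by apply/rowP => b; rewrite mxE mulrAC -uv mulfK.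
have k0 : u 0 a / v 0 a != 0.
  by apply: contra u0 => /eqP k0; rewrite uE k0 scale0r.
apply/vspaceP => x; rewrite uE; apply/vlineP/vlineP => -[k ->].
  by exists (k * (u 0 a / v 0 a)); rewrite scalerA.
by exists (k / (u 0 a / v 0 a)); rewrite scalerA divfK.
Qed.

Lemma on_line_vline u v : on_line <[v]>%VS (linear_form u) <-> dot u v = 0.
Proof.
split=> [/(_ _ (memv_line v))|uv x /vlineP[k ->]]; rewrite meval_linear_form_dot //.
by rewrite dotZ uv mulr0.
Qed.

Lemma dim1_vline (p : {vspace 'rV[K]_3}) : \dim p = 1%N -> exists2 v, v != 0 & p = <[v]>%VS.
Proof.
move=> p1; have v0 : vpick p != 0 by rewrite vpick0 -dimv_eq0 p1.
exists (vpick p) => //; apply/esym/eqP; rewrite eqEdim p1 dim_vline v0 andbT.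
by rewrite -memvE memv_pick.
Qed.
End Points.

Section TjurinaNumber.
Variables (K : numFieldType) (M : nat) (l : nat -> 'rV[K]_3).
Hypothesis l_npar : forall i j, (i < M)%N -> (j < M)%N -> i != j -> ~~ parallel (l i) (l j).

Definition crossing i j : {vspace 'rV[K]_3} := <[cross (l i) (l j)]>%VS.

Definition crossings_on j : seq {vspace 'rV[K]_3} := [seq crossing i j | i <- iota 0 j].

Let incident (p : {vspace 'rV[K]_3}) i := `[< on_line p (linear_form (l i)) >].

Let mult d p := count (incident p) (iota 0 d).

Let cross_neq0 i j : (i < M)%N -> (j < M)%N -> i != j -> cross (l i) (l j) != 0.
Proof. by move=> iM jM ij; apply: contra (l_npar iM jM ij) => /eqP/cross_eq0. Qed.

Let crossingP p i j : \dim p = 1%N -> (i < M)%N -> (j < M)%N -> i != j ->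
  incident p i && incident p j = (p == crossing i j).
Proof.
move=> /dim1_vline[v v0 ->] iM jM ij; rewrite /incident.
rewrite vline_parallel ?cross_neq0 //; apply/andP/idP => [[]|vc].
  by move=> /asboolP/on_line_vline iv /asboolP/on_line_vline jv; apply: parallel_cross.
have cE : <[v]>%VS = crossing i j by apply/eqP; rewrite vline_parallel ?cross_neq0.
by rewrite cE; split; apply/asboolP/on_line_vline; [apply: dot_crossl|apply: dot_crossr].
Qed.

(** The crossings of all [M] lines contain every point of multiplicity at least
two of each subarrangement, so the Tjurina numbers of all subarrangements are
sums over this one index set. *)
Let points := undup [seq crossing ij.1 ij.2 |
  ij <- [seq (i, j) | i <- iota 0 M, j <- iota 0 M] & ij.1 != ij.2].

Let pointsP p : reflect (exists i j, [/\ (i < M)%N, (j < M)%N, i != j & p = crossing i j])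
  (p \in points).
Proof.
rewrite mem_undup; apply: (iffP mapP) => [[[i j]]|[i [j [iM jM ij ->]]]].
  rewrite mem_filter => /andP[ij /allpairsP[[i' j'] [/=]]].
  rewrite !mem_iota /= !add0n => iM jM [ei ej] ->; exists i, j.
  by rewrite ij ei ej.
exists (i, j) => //; rewrite mem_filter ij; apply/allpairsP; exists (i, j).
by rewrite /= !mem_iota.
Qed.

Let points_dim p : p \in points -> \dim p = 1%N.
Proof. by move=> /pointsP[i [j [iM jM ij ->]]]; rewrite dim_vline cross_neq0. Qed.

(** Points that lie on a single line, or on none, contribute zero. *)
Let T d := (\sum_(p <- points) (mult d p - 1) ^ 2)%N.

Let multS d p : mult d.+1 p = (mult d p + incident p d)%N.
Proof. by rewrite /mult -addn1 iotaD count_cat /= addn0. Qed.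

Let T_step d : (d < M)%N ->
  (T d.+1 + size (undup (crossings_on d)) = T d + 2 * d)%N.
Proof.
move=> dM.
have incP i p : (i < d)%N -> p \in points ->
    incident p i && incident p d = (p == crossing i d).
  move=> id pP; apply: crossingP => //; first exact: points_dim.
    by apply: ltn_trans id dM.
  by rewrite neq_ltn id.
(* The list [crossings_on d] may repeat points; each is counted once here. *)
have sE : size (undup (crossings_on d)) =
    (\sum_(p <- points) (incident p d && (0 < mult d p)))%N.
  rewrite -[RHS]big_mkcond /= sum1_count -size_filter; apply: perm_size.
  apply: uniq_perm; rewrite ?undup_uniq ?filter_uniq ?undup_uniq // => p.
  rewrite mem_undup mem_filter; apply/mapP/andP => [[ i ]|[]].
    rewrite mem_iota /= add0n => id ->.
    have pP : crossing i d \in points.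
      apply/pointsP; exists i, d; split=> //; last by rewrite neq_ltn id.
      by apply: ltn_trans id dM.
    split=> //; move: (incP i _ id pP); rewrite eqxx => /andP[iI ->] /=.
    by rewrite -has_count; apply/hasP; exists i; rewrite // mem_iota.
  move=> /andP[pd]; rewrite -has_count => /hasP[ i ].
  rewrite mem_iota /= add0n => id pi pP.
  by exists i; [rewrite mem_iota|apply/eqP; rewrite -incP ?pi].
(* Each earlier line meets the new one in exactly one point. *)
have mE : (\sum_(p <- points) incident p d * mult d p = d)%N.
  transitivity (\sum_(i <- iota 0 d) 1)%N; last by rewrite sum1_size size_iota.
  under eq_bigr => p _ do rewrite /mult -sum1_count big_mkcond big_distrr /=.
  rewrite exchange_big /= [LHS]big_seq [RHS]big_seq; apply: eq_bigr => i.
  rewrite mem_iota /= add0n => id.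
  have pP : crossing i d \in points.
    apply/pointsP; exists i, d; split=> //; last by rewrite neq_ltn id.
    by apply: ltn_trans id dM.
  rewrite (bigD1_seq (crossing i d)) ?undup_uniq //=.
  have /andP[-> ->] : incident (crossing i d) i && incident (crossing i d) d.
    by rewrite incP ?eqxx.
  rewrite big_seq_cond big1 // => p /andP[pP' pid].
  have := incP i p id pP'; rewrite (negPf pid).
  by case: (incident p i); case: (incident p d).
rewrite sE -[X in (_ + 2 * X)%N]mE big_distrr /= /T -!big_split /=; apply: eq_bigr => p _.
rewrite multS; case: (incident p d) => /=; last lia.
by case: (mult d p) => [|m] //=; rewrite ?addn1 ?subn1 /=; nia.
Qed.

Lemma tjurina_points d : (d <= M)%N ->
  global_tjurina (fun i : 'I_d => linear_form (l i)) = T d.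
Proof.
move=> dM; rewrite /global_tjurina.
have multE p : #|[pred i : 'I_d | `[< on_line p (linear_form (l i)) >]]| = mult d p.
  rewrite cardE /enum_mem size_filter.
  have -> : mult d p = count (incident p) [seq val i | i <- Finite.enum 'I_d].
    by rewrite -enumT val_enum_ord.
  by rewrite count_map; apply: eq_count => i.
have mult_le p : (mult d p <= d)%N.
  by apply: leq_trans (count_size _ _) _; rewrite size_iota.
have nbE j : (1 < j)%N -> nb_multiple_points (fun i : 'I_d => linear_form (l i)) j =
    (\sum_(p <- points) (mult d p == j))%N.
  move=> j1; rewrite /nb_multiple_points.
  have -> : multiple_points (fun i : 'I_d => linear_form (l i)) j =
      [set` [fset p in [seq p <- points | mult d p == j]]%fset]%classic.
    apply/seteqP; split=> p /=; rewrite !inE mem_filter; last first.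
      by move=> /andP[/eqP mj /points_dim pd]; split; rewrite ?multE.
    move=> [p1]; rewrite multE => mj; rewrite mj eqxx /=; apply/pointsP.
    have : (1 < count (incident p) (iota 0 d))%N by rewrite -/(mult d p) mj.
    rewrite -size_filter; case E: (filter _ _) => [|a [|b s]] // _.
    have := filter_uniq (incident p) (iota_uniq 0 d); rewrite E /= inE negb_or.
    move=> /andP[/andP[ab _] _].
    have sub c : c \in [:: a, b & s] -> incident p c /\ (c < M)%N.
      rewrite -E mem_filter mem_iota /= add0n => /andP[-> cd]; split=> //.
      exact: leq_trans cd dM.
    have [pa aM] := sub a (mem_head _ _).
    have [pb bM] := sub b (mem_behead (s := [:: a, b & s]) (mem_head _ _)).
    by exists a, b; split=> //; apply/eqP; rewrite -crossingP // pa pb.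
  rewrite set_fsetK card_fseq undup_id ?filter_uniq ?undup_uniq // size_filter.
  by rewrite -sum1_count big_mkcond.
rewrite big_nat_cond.
under eq_bigr => j /andP[/andP[j1 _] _] do rewrite (nbE j j1) big_distrl /=.
rewrite -big_nat_cond exchange_big /= /T; apply: eq_bigr => p _.
have [m1|m1] := leqP (mult d p) 1.
  rewrite (eqP (_ : mult d p - 1 == 0)%N) //.
  rewrite big_nat_cond big1 // => j /andP[/andP[j1 _] _].
  by rewrite (_ : _ == _ = false) //; lia.
rewrite (bigD1_seq (mult d p)) ?iota_uniq ?mem_index_iota ?m1 ?ltnS ?mult_le //=.
rewrite eqxx mul1n big1 ?addn0 // => j jm.
by rewrite eq_sym (negPf jm).
Qed.

Lemma tjurina_addition d : (d < M)%N ->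
  (global_tjurina (fun i : 'I_d.+1 => linear_form (l i)) + size (undup (crossings_on d)) =
   global_tjurina (fun i : 'I_d => linear_form (l i)) + 2 * d)%N.
Proof. by move=> dM; rewrite !tjurina_points ?T_step // ltnW. Qed.

Lemma tjurina0 : global_tjurina (fun i : 'I_0 => linear_form (l i)) = 0%N.
Proof. by rewrite tjurina_points // /T big1. Qed.
End TjurinaNumber.

(** * Four pencils of lines: counting intersection points *)

Inductive affine_line :=
  | AtInfinity
  | Vertical of nat
  | Horizontal of nat
  | Diagonal of nat
  | Antidiagonal of nat.

Section FourPencils.
Variable h : nat.
Let n := (2 * h)%N.
Let nE : n = (2 * h)%N := erefl.

(** The constants [m] of the lines [x + y = m].  For [i <= h] the line contains
[h - i] grid points, and [h] lines [x - y = c] meet it on a vertical or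
horizontal line; for larger [i] it misses the grid and [n - i] lines
[x - y = c] meet it on a horizontal line.  In both cases there are [n - i]
coincidences. *)
Definition offset i : nat :=
  if (i <= h)%N then (2 * n + 1 - h + i)%N else (2 * n + 1 + 2 * (i - h))%N.

Definition arrangement_line i : affine_line :=
  if i == 0%N then AtInfinity
  else if (i <= n)%N then Vertical i
  else if (i <= 2 * n)%N then Horizontal (i - n)
  else if (i <= 3 * n)%N then Diagonal (i - 2 * n)
  else Antidiagonal (offset (i - 3 * n)).

Variant arrangement_line_spec i : affine_line -> Prop :=
  | SpecAtInfinity of i = 0%N : arrangement_line_spec i AtInfinity
  | SpecVertical of (0 < i <= n)%N : arrangement_line_spec i (Vertical i)
  | SpecHorizontal b of (0 < b <= n)%N & i = (n + b)%N :
      arrangement_line_spec i (Horizontal b)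
  | SpecDiagonal c of (0 < c <= n)%N & i = (2 * n + c)%N :
      arrangement_line_spec i (Diagonal c)
  | SpecAntidiagonal j of (0 < j)%N & i = (3 * n + j)%N :
      arrangement_line_spec i (Antidiagonal (offset j)).

Lemma arrangement_lineP i : arrangement_line_spec i (arrangement_line i).
Proof.
rewrite /arrangement_line; case: eqVneq => [|i0]; first exact: SpecAtInfinity.
case: leqP => i1; first by apply: SpecVertical; lia.
case: leqP => i2; first by apply: SpecHorizontal; lia.
case: leqP => i3; first by apply: SpecDiagonal; lia.
by apply: SpecAntidiagonal; lia.
Qed.

Lemma offset_gt j : (0 < j)%N -> (n < offset j)%N.
Proof. by rewrite /offset; case: ifP; lia. Qed.

Lemma offset_inj i j : offset i = offset j -> i = j.
Proof. by rewrite /offset; case: ifP; case: ifP; lia. Qed.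

(** The place on [D] where it meets an earlier line [E], as a value of the
parameter used by [point_at] below; [0] stands for the point at infinity, and
all affine intersections have positive parameters.  On [x + y = m] the parameter
is [2 x], so that the intersection with [x - y = c] is integral. *)
Definition label (D E : affine_line) : nat :=
  match D, E with
  | Horizontal _, Vertical a => a
  | Diagonal _, Vertical a => a
  | Diagonal c, Horizontal b => (b + c)%N
  | Antidiagonal _, Vertical a => (2 * a)%N
  | Antidiagonal m, Horizontal b => (2 * (m - b))%N
  | Antidiagonal m, Diagonal c => (m + c)%N
  | _, _ => 0%N
  end.

Definition labels d : seq nat :=
  [seq label (arrangement_line d) (arrangement_line i) | i <- iota 0 d].

Lemma mem0_labels d : (0 < d)%N -> 0%N \in labels d.
Proof.
move=> d0; apply/mapP; exists 0%N; first by rewrite mem_iota.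
by case: (arrangement_line d).
Qed.

Lemma size_undup_labels d (t : seq nat) : uniq t -> labels d =i t -> size (undup (labels d)) = size t.
Proof.
move=> tu dt; apply: perm_size; apply: uniq_perm; rewrite ?undup_uniq // => x.
by rewrite mem_undup dt.
Qed.

Lemma size_labels_vertical d : (0 < d <= n)%N -> size (undup (labels d)) = 1%N.
Proof.
move=> dn; rewrite (@size_undup_labels d [:: 0%N]) // => x; rewrite inE.
apply/mapP/eqP => [[i _ ->]|->].
  by case: arrangement_lineP; rewrite //; lia.
exists 0%N; first by rewrite mem_iota; lia.
by case: (arrangement_line d).
Qed.

Lemma size_labels_horizontal d : (n < d <= 2 * n)%N -> size (undup (labels d)) = n.+1.
Proof.
move=> dn; rewrite (@size_undup_labels d (iota 0 n.+1)) ?size_iota ?iota_uniq // => x.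
rewrite mem_iota; apply/mapP/idP => [[ i ]|xn].
  rewrite mem_iota => id ->; case: (arrangement_lineP d); try by lia.
  by move=> b _ _; case: (arrangement_lineP i); rewrite //=; lia.
exists x; first by rewrite mem_iota; lia.
case: (arrangement_lineP d); try by lia.
by move=> b _ _; case: (arrangement_lineP x); rewrite //=; lia.
Qed.

Lemma size_labels_diagonal d : (2 * n < d <= 3 * n)%N ->
  size (undup (labels d)) = (d - n + 1)%N.
Proof.
move=> dn; rewrite (@size_undup_labels d (iota 0 (d - n + 1))) ?size_iota ?iota_uniq // => x.
rewrite mem_iota; apply/mapP/idP => [[ i ]|xn].
  rewrite mem_iota => id ->; case: (arrangement_lineP d); try by lia.
  by move=> c cn dE; case: (arrangement_lineP i); rewrite //=; lia.
pose c := (d - 2 * n)%N.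
exists (if (x <= n)%N then x else (x - c + n)%N); first by rewrite mem_iota; case: ifP; lia.
case: (arrangement_lineP d); try by lia.
by move=> c' _ dE; case: arrangement_lineP; rewrite /= /c; case: ifP; lia.
Qed.

(** In the parameter [2 x] the lines [x - y = c] contribute [m + 1, ..., m + n]:
as [n = 2 h], exactly [h] of these values are odd, hence distinct from the even
values of the vertical and horizontal lines.  The even values of all three
pencils are the doubles of [halves], which has a gap when [j > h]; [0] is the
point at infinity. *)
Lemma size_labels_antidiagonal d : (3 * n < d <= 4 * n)%N ->
  size (undup (labels d)) = (d - n + 1)%N.
Proof.
move=> dn; have [j dE] : exists j, d = (3 * n + j)%N by exists (d - 3 * n)%N; lia.
have [m mj] : exists m, offset j = m by exists (offset j).
have mE : m = if (j <= h)%N then (2 * n + 1 - h + j)%N else (2 * n + 1 + 2 * (j - h))%N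
  by rewrite -mj.
have jn : (0 < j <= n)%N by lia.
pose halves := iota 0 n.+1 ++
  (if (j <= h)%N then iota n.+1 (m - n - 1) else iota (m - n - (j - h)) (n + (j - h))).
pose odds := iota (uphalf m) h.
have halvesE y : (y \in halves) =
    ((y <= n) || (if j <= h then n < y < m else m - n - (j - h) <= y < m))%N.
  rewrite mem_cat mem_iota; move: mE jn; case: ifP => jh mE jn; rewrite mem_iota; lia.
have oddsE y : (y \in odds) = (uphalf m <= y < uphalf m + h)%N by rewrite mem_iota.
rewrite (@size_undup_labels d ([seq (2 * y)%N | y <- halves] ++ [seq (2 * y + 1)%N | y <- odds])).
- rewrite size_cat !size_map size_cat !size_iota.
  by move: mE; case: ifP => jh mE; rewrite !size_iota; lia.
- rewrite cat_uniq !map_inj_uniq ?iota_uniq; try by move=> a b; lia.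
  apply/and3P; split=> //; last first.
    by apply/hasPn => x /mapP[y _ ->]; apply/mapP => -[z _]; lia.
  rewrite cat_uniq iota_uniq /=; apply/andP; split; last by case: ifP; rewrite iota_uniq.
  apply/hasPn => x; move: mE jn.
  by case: ifP => jh mE jn; rewrite -[0 :: _]/(iota 0 n.+1) !mem_iota; lia.
have dA : arrangement_line d = Antidiagonal m.
  case: (arrangement_lineP d); try by lia.
  by move=> j' _; rewrite dE -mj => /addnI ->.
move=> x; rewrite mem_cat; apply/mapP/orP => [[ i ]|[] /mapP[y]].
- rewrite mem_iota dA => id ->.
  have even_in y : (y \in halves) -> 2 * y \in [seq (2 * y)%N | y <- halves] by exact: map_f.
  case: (arrangement_lineP i) => /=.
  + by left; apply: (even_in 0%N); rewrite halvesE.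
  + by move=> i1; left; apply: even_in; rewrite halvesE; lia.
  + move=> b b1 _; left; apply: even_in; rewrite halvesE.
    by move: mE jn; case: ifP => jh mE jn; lia.
  + move=> c c1 _; have [mc|mc] := boolP (odd (m + c)).
      right; apply/mapP; exists (m + c)./2; last by lia.
      by rewrite oddsE; lia.
    left; have -> : (m + c = 2 * (m + c)./2)%N by lia.
    apply: even_in; rewrite halvesE.
    by move: mE jn; case: ifP => jh mE jn; lia.
  + by move=> j' _ _; left; apply: (even_in 0%N); rewrite halvesE.
- rewrite halvesE dA => y_in ->.
  (* The abscissa [y] belongs to a vertical line, or else to the horizontal line
     with [b = m - y], or else to the line [x - y = c] with [c = 2 y - m]. *)
  exists (if (y <= n)%N then y else if (m - n <= y)%N then (n + (m - y))%N else (2 * n + (2 * y - m))%N).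
    rewrite mem_iota; move: mE jn y_in; case: (leqP j h) => jh mE jn y_in.
      by case: ifP => yn; [|case: ifP => ym]; lia.
    by case: ifP => yn; [|case: ifP => ym]; lia.
  move: mE jn y_in; case: (leqP j h) => jh mE jn y_in.
    by case: ifP => yn; [|case: ifP => ym]; case: arrangement_lineP => /=; lia.
  by case: ifP => yn; [|case: ifP => ym]; case: arrangement_lineP => /=; lia.
- rewrite oddsE dA => y_in ->.
  exists (2 * n + (2 * y + 1 - m))%N; first by rewrite mem_iota; lia.
  by case: arrangement_lineP => /=; lia.
Qed.

End FourPencils.

(** * Four pencils of lines: coordinates and invariants *)

Section Coordinates.
Variable K : numFieldType.

Definition row3 (a b c : K) : 'rV[K]_3 := \row_i nth 0 [:: a; b; c] i.

Definition coef (D : affine_line) : 'rV[K]_3 :=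
  match D with
  | AtInfinity => row3 0 0 1
  | Vertical a => row3 1 0 (- a%:R)
  | Horizontal b => row3 0 1 (- b%:R)
  | Diagonal c => row3 1 (- 1) (- c%:R)
  | Antidiagonal m => row3 1 1 (- m%:R)
  end.

Definition direction (D : affine_line) : 'rV[K]_3 :=
  match D with
  | AtInfinity => row3 1 0 0
  | Vertical _ => row3 0 1 0
  | Horizontal _ => row3 1 0 0
  | Diagonal _ => row3 1 1 0
  | Antidiagonal _ => row3 1 (- 1) 0
  end.

Definition base (D : affine_line) : 'rV[K]_3 :=
  match D with
  | AtInfinity => row3 0 1 0
  | Vertical a => row3 a%:R 0 1
  | Horizontal b => row3 0 b%:R 1
  | Diagonal c => row3 0 (- c%:R) 1
  | Antidiagonal m => row3 0 (2 * m)%:R 2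
  end.

(** Every affine line is parametrized by [base + t * direction], with its point at
infinity at [t = 0], a value at which no affine crossing occurs. *)
Definition point_at (D : affine_line) (t : nat) : 'rV[K]_3 :=
  if t == 0%N then direction D else base D + t%:R *: direction D.

Lemma dot_row3 (c : 'rV[K]_3) x y z :
  dot (row3 x y z) c = x * c 0 o0 + y * c 0 o1 + z * c 0 o2.
Proof. by rewrite /dot sum3E !mxE. Qed.

Lemma dot_coef_direction D : dot (coef D) (direction D) = 0.
Proof. by case: D => *; rewrite dot_row3 !mxE /=; ring. Qed.

Lemma dot_coef_base D : dot (coef D) (base D) = 0.
Proof. by case: D => *; rewrite dot_row3 !mxE /=; ring. Qed.

Lemma dot_coef_point_at D t : dot (coef D) (point_at D t) = 0.
Proof.
rewrite /point_at; case: (t == 0%N); first exact: dot_coef_direction.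
by rewrite dotD dotZ dot_coef_direction dot_coef_base mulr0 addr0.
Qed.

Lemma coef_plane D p : dot (coef D) p = 0 ->
  exists a b, p = a *: direction D + b *: base D.
Proof.
case: D => [|a|b|c|m]; rewrite dot_row3 => p0.
- exists (p 0 o0), (p 0 o1); apply/rowP; elim/ord3_ind; rewrite !mxE /=.
  + ring.
  + ring.
  + by apply: subr0_eq; rewrite -[RHS]p0; ring.
- exists (p 0 o1), (p 0 o2); apply/rowP; elim/ord3_ind; rewrite !mxE /=.
  + by apply: subr0_eq; rewrite -[RHS]p0; ring.
  + ring.
  + ring.
- exists (p 0 o0), (p 0 o2); apply/rowP; elim/ord3_ind; rewrite !mxE /=.
  + ring.
  + by apply: subr0_eq; rewrite -[RHS]p0; ring.
  + ring.
- exists (p 0 o0), (p 0 o2); apply/rowP; elim/ord3_ind; rewrite !mxE /=.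
  + ring.
  + by apply/esym/subr0_eq; rewrite -[RHS]p0; ring.
  + ring.
- exists (p 0 o0), (p 0 o2 / 2); apply/rowP; elim/ord3_ind; rewrite !mxE /=.
  + ring.
  + by apply: subr0_eq; rewrite -[RHS]p0 natrM; field.
  + by field.
Qed.

Lemma point_at_neq0 D t : point_at D t != 0.
Proof.
rewrite /point_at; case: (t =P 0%N) => [_|t0]; apply/rV0Pn.
  case: D => *; [exists o0|exists o1|exists o0|exists o0|exists o0];
  by rewrite !mxE /= oner_eq0.
have tn0 : t%:R != 0 :> K by rewrite pnatr_eq0; apply/eqP.
case: D => *; [exists o0|exists o2|exists o2|exists o2|exists o2]; rewrite !mxE /=.
- by rewrite add0r mulr1.
- by rewrite mulr0 addr0 oner_eq0.
- by rewrite mulr0 addr0 oner_eq0.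
- by rewrite mulr0 addr0 oner_eq0.
- by rewrite mulr0 addr0 pnatr_eq0.
Qed.

Lemma point_at_inj D t t' : D <> AtInfinity ->
  parallel (point_at D t) (point_at D t') -> t = t'.
Proof.
move=> DI /parallelP par.
have [k [dk d2 b2]] : exists k, [/\ direction D 0 k = 1, direction D 0 o2 = 0
    & base D 0 o2 != 0].
  case: D DI {par} => [|a|b|c|m] // _; [exists o1|exists o0|exists o0|exists o0];
  by split; rewrite !mxE /= ?oner_eq0 ?pnatr_eq0.
have p2 s : s != 0%N -> point_at D s 0 o2 = base D 0 o2.
  by move=> /negPf s0; rewrite /point_at s0 !mxE d2 mulr0 addr0.
have pk s : s != 0%N -> point_at D s 0 k = base D 0 k + s%:R.
  by move=> /negPf s0; rewrite /point_at s0 !mxE dk mulr1.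
have p02 : point_at D 0 0 o2 = 0 by [].
have p0k : point_at D 0 0 k = 1 by [].
have := par k o2; have [->|t0] := eqVneq t 0%N; have [->//|t'0] := eqVneq t' 0%N.
- by rewrite p02 p0k p2 // mul0r mul1r => /eqP; rewrite (negPf b2).
- by rewrite p02 p0k p2 // mulr0 mulr1 => /esym/eqP; rewrite (negPf b2).
- rewrite !p2 // !pk // mulrC => /(mulfI b2)/addrI/eqP.
  by rewrite eqr_nat => /eqP.
Qed.

Variable h : nat.
Let n := (2 * h)%N.
Let nE : n = (2 * h)%N := erefl.

Definition line_coef i : 'rV[K]_3 := coef (arrangement_line h i).

Lemma line_coef_neq0 i : line_coef i != 0.
Proof.
apply/rV0Pn; rewrite /line_coef.
case: arrangement_lineP => *; [exists o2|exists o0|exists o1|exists o0|exists o0];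
by rewrite !mxE /= oner_eq0.
Qed.

Lemma coef_parallel D E : parallel (coef D) (coef E) -> D = E.
Proof.
move=> /parallelP par; have e01 := par o0 o1; have e02 := par o0 o2; have e12 := par o1 o2.
have absurd (x y c : K) : x = y -> (x - y) * c = 1 -> False.
  by move=> ->; rewrite subrr mul0r => /esym/eqP; rewrite oner_eq0.
have two0 : 2 != 0 :> K by rewrite pnatr_eq0.
case: D e01 e02 e12 {par} => [|a|b|c|m]; case: E => [|a'|b'|c'|m'] //;
  rewrite !mxE /= => e01 e02 e12.
all: try by [exfalso; apply: (absurd _ _ 1 e01); ring
  | exfalso; apply: (absurd _ _ (- 1) e01); ring
  | exfalso; apply: (absurd _ _ 1 e02); ring
  | exfalso; apply: (absurd _ _ (- 1) e02); ring
  | exfalso; apply: (absurd _ _ 1 e12); ring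
  | exfalso; apply: (absurd _ _ (- 1) e12); ring
  | exfalso; apply: (absurd _ _ (1 / 2) e01); field
  | exfalso; apply: (absurd _ _ (- 1 / 2) e01); field].
all: congr (_ _); apply/eqP; rewrite -(eqr_nat K); apply/eqP.
- by apply: oppr_inj; move: e02; rewrite mul1r mulr1.
- by apply: oppr_inj; move: e12; rewrite mul1r mulr1.
- by apply: oppr_inj; move: e02; rewrite mul1r mulr1.
- by apply: oppr_inj; move: e02; rewrite mul1r mulr1.
Qed.

Lemma line_coef_npar i j : i != j -> ~~ parallel (line_coef i) (line_coef j).
Proof.
apply: contra => /coef_parallel; case: arrangement_lineP; case: arrangement_lineP => //.
- by move=> -> ->.
- by move=> _ _ [->].
- by move=> b _ -> b' _ -> [->].
- by move=> b _ -> b' _ -> [->].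
- by move=> b _ -> b' _ -> [/offset_inj ->].
Qed.

Lemma point_at_label_on_line i j : (i < j)%N ->
  dot (line_coef i) (point_at (arrangement_line h j)
    (label (arrangement_line h j) (arrangement_line h i))) = 0.
Proof.
rewrite /line_coef /point_at => ij.
case: (arrangement_lineP h j) => [j0|jn|b bn jE|c cn jE|m m0 jE];
case: (arrangement_lineP h i) => [i0|i1|b' bn' iE|c' cn' iE|m' m0' iE] /=;
  try by [exfalso; lia].
all: try (case: ifP => t0; try by [exfalso; lia]).
all: rewrite dot_row3 !mxE /= ?natrM ?natrD; try by ring.
  by have := offset_gt h m0; lia.
have bm : (b' <= offset h m)%N by have := offset_gt h m0; lia.
by rewrite natrB //; ring.
Qed.

Lemma crossing_point_at i j : (i < j)%N ->
  crossing line_coef i j = <[point_at (arrangement_line h j)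
    (label (arrangement_line h j) (arrangement_line h i))]>%VS.
Proof.
move=> ij; have ij' : i != j by rewrite neq_ltn ij.
have c0 : cross (line_coef i) (line_coef j) != 0.
  by apply: contra (line_coef_npar ij') => /eqP/cross_eq0.
apply/eqP; rewrite /crossing vline_parallel ?point_at_neq0 // parallel_sym.
by apply: parallel_cross; [exact: point_at_label_on_line|exact: dot_coef_point_at].
Qed.

(** Distinct parameters are distinct points, so that counting crossings is
counting labels. *)
Lemma size_crossings_on j : (0 < j)%N ->
  size (undup (crossings_on line_coef j)) = size (undup (labels h j)).
Proof.
move=> j0; pose g t := <[point_at (arrangement_line h j) t]>%VS.
have -> : crossings_on line_coef j = map g (labels h j).
  rewrite /crossings_on /labels -map_comp; apply/eq_in_map => i.
  by rewrite mem_iota /= add0n => /crossing_point_at.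
rewrite undup_map_inj ?size_map // => t t' /eqP.
rewrite vline_parallel ?point_at_neq0 //; apply: point_at_inj.
by case: arrangement_lineP => // j0'; rewrite j0' in j0.
Qed.

(** The induction starts with the pencil of the first [n + 1] lines, where two
lines already force a constant [W] to vanish. *)
Lemma rigid_line_coef e : (0 < n)%N -> (e <= 3 * n)%N -> rigid line_coef (n.+1 + e) e.
Proof.
move=> n0; elim: e => [_|e IH en].
  rewrite addn0 -(subnKC n0); elim: (n - 1)%N => [|k IHk]; last by rewrite addnS; apply: rigidS.
  by rewrite addn0; apply: rigid2; apply: line_coef_npar.
set d := (n.+1 + e)%N in IH *.
have d0 : (0 < d)%N by [].
rewrite addnS -/d.
pose ts := [seq t <- undup (labels h d) | t != 0%N].
have size_ts : (e < size ts)%N.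
  have -> : size ts = (size (undup (labels h d))).-1.
    have := rem_filter 0%N (undup_uniq (labels h d)).
    rewrite /ts => <-.
    by rewrite size_rem // mem_undup mem0_labels.
  have [dn|dn] := leqP d (2 * n); first by rewrite size_labels_horizontal; lia.
  have [dn'|dn'] := leqP d (3 * n); first by rewrite size_labels_diagonal; lia.
  by rewrite size_labels_antidiagonal; lia.
apply: (@rigid_step _ _ _ _ _ (direction (arrangement_line h d)) (base (arrangement_line h d))
  [seq t%:R | t <- ts] (IH (ltnW en))).
- exact: line_coef_neq0.
- by move=> i id; apply: line_coef_npar; rewrite neq_ltn id.
- exact: coef_plane.
- exact: dot_coef_direction.
- exact: dot_coef_base.
- rewrite map_inj_uniq ?filter_uniq ?undup_uniq // => t t' /eqP.
  by rewrite eqr_nat => /eqP.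
- by rewrite size_map.
- exists 0%N => //; have := point_at_label_on_line d0.
  by case: (arrangement_line h d).
- move=> c /mapP[t]; rewrite mem_filter mem_undup => /andP[t0 /mapP[ i ]].
  rewrite mem_iota /= add0n => id tE ->; exists i => //.
  by have := point_at_label_on_line id; rewrite -tE /point_at (negPf t0).
Qed.

(** Summing [2 D - s] over the pencil gives [n^2], over the horizontal lines
[2 n^2], and over the remaining [e] lines [3 n e + 'C(e, 2)]. *)
Lemma tjurina_line_coef e : (e <= 2 * n)%N ->
  global_tjurina (fun i : 'I_(2 * n + 1 + e) => linear_form (line_coef i)) =
    (3 * n ^ 2 + 3 * n * e + 'C(e, 2))%N.
Proof.
pose T d := global_tjurina (fun i : 'I_d => linear_form (line_coef i)).
have TS d : (T d.+1 + size (undup (crossings_on line_coef d)) = T d + 2 * d)%N.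
  by apply: (@tjurina_addition _ d.+1) => // i j _ _; apply: line_coef_npar.
have T1 : T 1%N = 0%N.
  have := TS 0%N; rewrite {2}/T (@tjurina0 _ 0 line_coef) //=; lia.
have Tv d : (d <= n)%N -> (T d.+1 = d ^ 2)%N.
  elim: d => [_|d IH dn]; first by rewrite T1.
  have := TS d.+1; rewrite size_crossings_on // size_labels_vertical; last lia.
  by rewrite IH ?(ltnW dn) //; nia.
have Th d : (d <= n)%N -> (T (n.+1 + d) = n ^ 2 + d * (n + d))%N.
  elim: d => [_|d IH dn]; first by rewrite addn0 Tv // mul0n addn0.
  have := TS (n.+1 + d)%N; rewrite size_crossings_on // size_labels_horizontal; last lia.
  by rewrite IH ?(ltnW dn) // -addnS; nia.
rewrite -/(T _); elim: e => [_|e IH en].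
  by have := Th n (leqnn n); rewrite (_ : (n.+1 + n = 2 * n + 1 + 0)%N) ?bin0n; [nia|lia].
have := TS (2 * n + 1 + e)%N; rewrite size_crossings_on; last lia.
have -> : size (undup (labels h (2 * n + 1 + e))) = (n + e + 2)%N.
  have [dn|dn] := leqP (2 * n + 1 + e) (3 * n).
    by rewrite size_labels_diagonal; lia.
  by rewrite size_labels_antidiagonal; lia.
by rewrite IH ?(ltnW en) // -addnS binS bin1; nia.
Qed.

Lemma card_pencil d : (n < d)%N -> #|[pred i : 'I_d | line_coef i 0 o1 == 0]| = n.+1.
Proof.
move=> nd; have -> : #|[pred i : 'I_d | line_coef i 0 o1 == 0]| =
    count (fun i => i <= n)%N (iota 0 d).
  rewrite cardE /enum_mem size_filter -val_enum_ord count_map enumT.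
  apply: eq_count => i /=; rewrite inE /line_coef.
  case: arrangement_lineP => *; rewrite mxE /= ?oppr_eq0 ?oner_eq0 ?eqxx; lia.
rewrite -(subnKC nd) iotaD count_cat -[RHS]addn0; congr (_ + _)%N.
  rewrite -[RHS](size_iota 0); apply/eqP; rewrite -all_count; apply/allP => i.
  by rewrite mem_iota.
by apply/eqP; rewrite -leqn0 leqNgt -has_count; apply/hasPn => i; rewrite mem_iota; lia.
Qed.

End Coordinates.

(** * Tjurina maximality *)

Section TjurinaMaximal.
Variables (K : numFieldType) (h e : nat).
Hypothesis h_gt0 : (0 < h)%N.
Hypothesis e_bounds : (0 < e <= 2 * (2 * h))%N.

Let d := (2 * (2 * h) + 1 + e)%N.
Let r := (2 * h + e)%N.
Let A (i : 'I_d) := linear_form (line_coef K h i).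

Lemma line_coef_arrangement : line_arrangement A.
Proof.
split=> [i|i|i j ij c]; first exact: dhomog_linear_form.
  by rewrite linear_form_eq0 line_coef_neq0.
have := @line_coef_npar K h i j ij; apply: contra => /eqP Aij.
apply/parallelP => a b.
have cE k : line_coef K h i 0 k = c * line_coef K h j 0 k.
  by rewrite -!mcoeff_linear_form -mcoeffZ -Aij.
by rewrite !cE; ring.
Qed.

Lemma line_coef_min_syzygy_degree : min_syzygy_degree A r.
Proof.
split.
  have -> : r = (d - (2 * h).+1)%N by rewrite /r /d; lia.
  apply: pencil_syzygy => [i _||]; [exact: line_coef_neq0|rewrite /d; lia|].
  by apply: card_pencil; rewrite /d; lia.
move=> s; apply: rigid_syzygy_degree => [i _|i j _ _||].
- exact: line_coef_neq0.
- exact: line_coef_npar.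
- by rewrite /d addn1.
have -> : d = ((2 * h).+1 + r)%N by rewrite /d /r; lia.
by apply: rigid_line_coef; rewrite /r; lia.
Qed.

Lemma line_coef_tjurina_maximal : tjurina_maximal r A.
Proof.
split; [exact: line_coef_arrangement|exact: line_coef_min_syzygy_degree|].
rewrite /A tjurina_line_coef; last lia.
rewrite /tjurina_max; have -> : (2 * r < d)%N = false by rewrite /r /d; lia.
have -> : (2 * r + 2 - d = e.+1)%N by rewrite /r /d; lia.
have C2 : (2 * 'C(e, 2) + e = e * e)%N.
  by elim: (e) => // k IH; rewrite binS bin1; lia.
rewrite binS bin1 /r /d; move: ('C(e, 2)) C2 => c C2; lia.
Qed.
End TjurinaMaximal.

Lemma real_line_coef (R : realType) h d :
  real_arrangement (fun i : 'I_d => linear_form (line_coef R[i] h i)).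
Proof.
move=> i; exists 1; first exact: oner_neq0.
rewrite scale1r; apply/mpolyOverP => m.
rewrite /linear_form raddf_sum; apply: rpred_sum => k _ /=.
rewrite mcoeffZ mcoeffX; apply: realM; last exact: realn.
rewrite /line_coef; elim/ord3_ind: k; case: (arrangement_line h i) => *;
  by rewrite mxE /= ?realN ?realn ?real0 ?real1.
Qed.

Theorem proposition4p6 (R : realType) (d r : nat) (hr0 : (0 < r)%N)
    (hd : (4 <= d)%N) (hk : odd (d - r))
    (hr1 : d%:R / 2 <= r%:R :> rat)
    (hr2 : r%:R <= 3 / 4 * (d%:R - 1) :> rat) :
  exists A : 'I_d -> {mpoly R[i][3]},
    real_arrangement A /\ tjurina_maximal r A.
Proof.
have hr1' : (d <= 2 * r)%N by rewrite -(ler_nat rat) natrM; lra.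
have hr2' : (4 * r + 3 <= 3 * d)%N by rewrite -(ler_nat rat) natrD !natrM; lra.
have [h [e [dE rE]]] : exists h e, d = (2 * (2 * h) + 1 + e)%N /\ r = (2 * h + e)%N.
  (* [2 h = n = d - r - 1], and [e] lines follow the grid of [2 n + 1]. *)
  by exists (d - r)./2, (2 * r + 1 - d)%N; lia.
subst d r.
exists (fun i : 'I__ => linear_form (line_coef R[i] h i)); split.
  exact: real_line_coef.
by apply: line_coef_tjurina_maximal; lia.
Qed.
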